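(* For all $x,y\in\mathbb{B}^2$, $$\tilde\tau_{\mathbb{B}^2}(x,y)\ge\begin{cases}\log\Big(1+2\sqrt{\frac{|x-y|\sqrt{|x+y|^2+|x-y|^2}}{4-|x+y|^2-|x-y|^2}}\Big), & \text{if } |x+y|\Big(1+\frac{4}{|x+y|^2+|x-y|^2}\Big)\le4,\\[2mm] \log\Big(1+\frac{2|x-y|}{\sqrt{(2-|x+y|)^2+|x-y|^2}}\Big), & \text{if } |x+y|\Big(1+\frac{4}{|x+y|^2+|x-y|^2}\Big)>4,\end{cases}$$ (for $x=y$ the left-hand side and both expressions are interpreted as $0$), and, whenever $|x+y|+|x-y|<2$, $$\tilde\tau_{\mathbb{B}^2}(x,y)\le\log\Big(1+\frac{2|x-y|}{\sqrt{(2-|x+y|)^2-|x-y|^2}}\Big).$$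
   Context: $\mathbb{B}^2$ is the open unit disk. For a proper subdomain $D\subsetneq\mathbb{R}^n$ and $x,y\in D$, $\tilde\tau_D(x,y)=\log\big(1+\sup_{p\in\partial D}\frac{|x-y|}{\sqrt{|x-p||y-p|}}\big)$ (the scale invariant Cassinian metric). *)

(* Defs.v *)
From Stdlib Require Import Reals ClassicalEpsilon.
Open Scope R_scope.

Definition point : Type := (R * R)%type.

Definition vadd (x y : point) : point := (fst x + fst y, snd x + snd y).
Definition vsub (x y : point) : point := (fst x - fst y, snd x - snd y).

Definition norm2 (x : point) : R := sqrt (fst x ^ 2 + snd x ^ 2).

Definition in_B2 (x : point) : Prop := norm2 x < 1.
Definition bd_B2 (p : point) : Prop := norm2 p = 1.

(* Least upper bound of a set of reals (chosen classically; it is the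
   supremum whenever the set is nonempty and bounded above). *)
Definition Rsup (E : R -> Prop) : R :=
  epsilon (inhabits 0) (fun s => is_lub E s).

(* Scale invariant Cassinian metric of a domain D given via its boundary bd:
   log(1 + sup_{p in bd} |x-y| / sqrt(|x-p| |y-p|)). *)
Definition sic_tau (bd : point -> Prop) (x y : point) : R :=
  ln (1 + Rsup (fun r => exists p, bd p /\
        r = norm2 (vsub x y) / sqrt (norm2 (vsub x p) * norm2 (vsub y p)))).

Definition tau_B2 (x y : point) : R := sic_tau bd_B2 x y.

(* Main.v *)
(** Put m = (x + y)/2, h = (x - y)/2 and F(p) = |x - p||y - p|; bounding the
    metric amounts to bounding the minimum of F over the unit circle. From
      F(p)^2 = (|p - m|^2 + |h|^2)^2 - 4 ((p - m).h)^2
    Cauchy-Schwarz gives F(p) >= (1 - |m|)^2 - |h|^2, whence the upper bound,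
    and p = m/|m| gives F(p) <= (1 - |m|)^2 + |h|^2, whence the second lower
    bound. For the first lower bound the extremal case is h orthogonal to m,
    where F is minimal at two points p0 of the circle symmetric about the line
    through 0 and m. In general, the Cassinian oval with foci x, y at the same
    level, rotated about m, must still reach the circle: either one of these
    two points lies in it, or the point where the ray from m along h or -h
    meets the circle does, being at most |p0 - m| away from m. *)

Require Import Defs.
From Stdlib Require Import Reals ClassicalEpsilon Lra Psatz.
Open Scope R_scope.

(** * Norms and the distance to the unit circle *)

Lemma norm2_sq (x : point) : norm2 x ^ 2 = fst x ^ 2 + snd x ^ 2.
Proof. unfold norm2. apply pow2_sqrt. nra. Qed.

Lemma norm2_ge0 (x : point) : 0 <= norm2 x.
Proof. apply sqrt_pos. Qed.

Lemma le_of_sq_le (u v : R) : 0 <= v -> u ^ 2 <= v ^ 2 -> u <= v.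
Proof. intros. nra. Qed.

Lemma in_B2_sq (x : point) : in_B2 x -> fst x ^ 2 + snd x ^ 2 < 1.
Proof.
intros H; unfold in_B2 in H; rewrite <- norm2_sq.
pose proof (norm2_ge0 x); nra.
Qed.

Lemma bd_B2_sq (p : point) : bd_B2 p <-> fst p ^ 2 + snd p ^ 2 = 1.
Proof.
unfold bd_B2; rewrite <- norm2_sq; pose proof (norm2_ge0 p); split; intros; nra.
Qed.

(** Reverse triangle inequality: after squaring it reduces to x.p <= |x|, which is Cauchy-Schwarz
    with |p| = 1. *)
Lemma dist_bd_B2_ge (x p : point) : bd_B2 p -> 1 - norm2 x <= norm2 (vsub x p).
Proof.
intros Hp; apply bd_B2_sq in Hp.
destruct (Rle_dec 1 (norm2 x)) as [H|H].
{ pose proof (norm2_ge0 (vsub x p)); lra. }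
apply le_of_sq_le; [apply norm2_ge0|].
rewrite norm2_sq; unfold vsub; simpl fst; simpl snd.
pose proof (norm2_sq x) as Hx; pose proof (norm2_ge0 x).
assert (fst x * fst p + snd x * snd p <= norm2 x).
{ apply le_of_sq_le; [assumption|].
  rewrite Hx; pose proof (pow2_ge_0 (fst x * snd p - snd x * fst p)).
  replace (fst x ^ 2 + snd x ^ 2) with ((fst x ^ 2 + snd x ^ 2) * (fst p ^ 2 + snd p ^ 2))
    by (rewrite Hp; ring).
  nra. }
nra.
Qed.

(** * The product of distances and the supremum defining the metric *)

Definition cassini (x y p : point) : R := norm2 (vsub x p) * norm2 (vsub y p).

(** The lower bound is positive and independent of [p], so the quotients in the metric are bounded
    above. *)
Lemma cassini_ge (x y p : point) : in_B2 x -> in_B2 y -> bd_B2 p ->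
  (1 - norm2 x) * (1 - norm2 y) <= cassini x y p.
Proof.
intros Hx Hy Hp; unfold in_B2 in *.
apply Rmult_le_compat; try lra; apply dist_bd_B2_ge; assumption.
Qed.

Lemma cassini_gt0 (x y p : point) : in_B2 x -> in_B2 y -> bd_B2 p ->
  0 < cassini x y p.
Proof.
intros Hx Hy Hp; pose proof (cassini_ge x y p Hx Hy Hp).
unfold in_B2 in *; nra.
Qed.

Lemma cassini_sq (x y p : point) : cassini x y p ^ 2 =
  ((fst x - fst p) ^ 2 + (snd x - snd p) ^ 2) *
  ((fst y - fst p) ^ 2 + (snd y - snd p) ^ 2).
Proof. unfold cassini; rewrite Rpow_mult_distr, !norm2_sq; reflexivity. Qed.

Lemma le_div_sqrt (v d G : R) : 0 < G -> 0 <= d -> v ^ 2 * G <= d ^ 2 ->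
  v <= d / sqrt G.
Proof.
intros HG Hd H.
pose proof (sqrt_lt_R0 G HG) as Hs; pose proof (pow2_sqrt G (Rlt_le _ _ HG)) as Hq.
apply (Rmult_le_reg_r (sqrt G)); [assumption|].
replace (d / sqrt G * sqrt G) with d by (field; lra).
apply le_of_sq_le; [assumption|]. rewrite Rpow_mult_distr, Hq; assumption.
Qed.

Lemma div_sqrt_le (v d G : R) : 0 < G -> 0 <= v -> d ^ 2 <= v ^ 2 * G ->
  d / sqrt G <= v.
Proof.
intros HG Hv H.
pose proof (sqrt_lt_R0 G HG) as Hs; pose proof (pow2_sqrt G (Rlt_le _ _ HG)) as Hq.
apply (Rmult_le_reg_r (sqrt G)); [assumption|].
replace (d / sqrt G * sqrt G) with d by (field; lra).
apply le_of_sq_le; [nra|]. rewrite Rpow_mult_distr, Hq; assumption.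
Qed.

(** Convertible with the set inside [tau_B2], so facts about its supremum transfer without
    rewriting. *)
Definition tau_set (x y : point) (r : R) : Prop :=
  exists p, bd_B2 p /\ r = norm2 (vsub x y) / sqrt (cassini x y p).

(** [Rsup] is picked by [epsilon], so a least upper bound must first be shown to exist: [cassini_ge]
    bounds the set and the point (1, 0) makes it nonempty. *)
Lemma Rsup_tau_set (x y : point) : in_B2 x -> in_B2 y ->
  is_lub (tau_set x y) (Rsup (tau_set x y)).
Proof.
intros Hx Hy; unfold Rsup; apply epsilon_spec.
destruct (completeness (tau_set x y)) as [l Hl]; [| |exists l; exact Hl].
- exists (norm2 (vsub x y) / sqrt ((1 - norm2 x) * (1 - norm2 y))).
  intros r (p & Hp & ->).
  pose proof (cassini_ge x y p Hx Hy Hp); unfold in_B2 in *.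
  assert (0 < (1 - norm2 x) * (1 - norm2 y)) by nra.
  apply Rmult_le_compat_l; [apply norm2_ge0|].
  apply Rinv_le_contravar; [apply sqrt_lt_R0; assumption|].
  apply sqrt_le_1_alt; assumption.
- exists (norm2 (vsub x y) / sqrt (cassini x y (1, 0))); exists (1, 0).
  split; [|reflexivity]. apply bd_B2_sq; simpl; ring.
Qed.

Lemma ln_le_compat (u v : R) : 0 < u -> u <= v -> ln u <= ln v.
Proof.
intros Hu [H| ->]; [left; apply ln_increasing; assumption|right; reflexivity].
Qed.

(** One boundary point suffices for a lower bound; squaring removes the root over F. *)
Lemma tau_B2_ge (x y p : point) (v : R) : in_B2 x -> in_B2 y -> bd_B2 p ->
  0 <= v -> v ^ 2 * cassini x y p <= norm2 (vsub x y) ^ 2 ->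
  ln (1 + v) <= tau_B2 x y.
Proof.
intros Hx Hy Hp Hv H.
destruct (Rsup_tau_set x y Hx Hy) as [Hub _].
apply ln_le_compat; [lra|]; apply Rplus_le_compat_l.
apply Rle_trans with (norm2 (vsub x y) / sqrt (cassini x y p)).
- apply le_div_sqrt; [apply cassini_gt0| apply norm2_ge0|]; assumption.
- apply Hub; exists p; split; [assumption|reflexivity].
Qed.

Lemma tau_B2_le (x y : point) (v : R) : in_B2 x -> in_B2 y -> 0 <= v ->
  (forall p, bd_B2 p -> norm2 (vsub x y) ^ 2 <= v ^ 2 * cassini x y p) ->
  tau_B2 x y <= ln (1 + v).
Proof.
intros Hx Hy Hv H.
destruct (Rsup_tau_set x y Hx Hy) as [Hub Hlub].
assert (H1 : bd_B2 (1, 0)) by (apply bd_B2_sq; simpl; ring).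
(* A nonnegative element makes the supremum nonnegative, which keeps the argument of [ln]
   positive. *)
assert (0 <= norm2 (vsub x y) / sqrt (cassini x y (1, 0))).
{ apply le_div_sqrt; [apply cassini_gt0; assumption|apply norm2_ge0|].
  replace (0 ^ 2) with 0 by ring; rewrite Rmult_0_l; apply pow2_ge_0. }
assert (0 <= Rsup (tau_set x y)).
{ eapply Rle_trans; [eassumption|].
  apply Hub; exists (1, 0); split; [assumption|reflexivity]. }
apply (ln_le_compat (1 + Rsup (tau_set x y))); [lra|]; apply Rplus_le_compat_l.
apply Hlub; intros r (p & Hp & ->).
apply div_sqrt_le; [apply cassini_gt0| |apply H]; assumption.
Qed.

(** * Cassinian ovals seen from the midpoint of their foci *)

(* [q] stands for p - m and [h] for (x - y) / 2, so that x - p = h - q and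
   y - p = - (h + q). *)
Lemma cassini_poly (q1 q2 h1 h2 : R) :
  ((h1 - q1) ^ 2 + (h2 - q2) ^ 2) * ((h1 + q1) ^ 2 + (h2 + q2) ^ 2) =
  (q1 ^ 2 + q2 ^ 2 + (h1 ^ 2 + h2 ^ 2)) ^ 2 - 4 * (q1 * h1 + q2 * h2) ^ 2.
Proof. ring. Qed.

(** By Lagrange's identity the two sides differ by [4 * (q1 * h2 - q2 * h1) ^ 2]. *)
Lemma cassini_poly_ge (q1 q2 h1 h2 : R) :
  (q1 ^ 2 + q2 ^ 2 - (h1 ^ 2 + h2 ^ 2)) ^ 2 <=
  ((h1 - q1) ^ 2 + (h2 - q2) ^ 2) * ((h1 + q1) ^ 2 + (h2 + q2) ^ 2).
Proof.
rewrite cassini_poly.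
pose proof (pow2_ge_0 (q1 * h2 - q2 * h1)). nra.
Qed.

(* In the frame where m = (a, 0), the factors are |x - p|^2 and |y - p|^2 for
   p = (c, z). *)
Lemma exists_close_point_nonneg (a h1 h2 : R) :
  let b2 := h1 ^ 2 + h2 ^ 2 in
  let r2 := a ^ 2 + b2 in
  0 <= a -> 0 <= h1 -> 0 <= h2 -> 0 < b2 ->
  (a + h1) ^ 2 + h2 ^ 2 < 1 ->
  a * (1 + r2) <= 2 * r2 ->
  exists c z, c ^ 2 + z ^ 2 = 1 /\
    ((h1 - (c - a)) ^ 2 + (h2 - z) ^ 2) * ((h1 + (c - a)) ^ 2 + (h2 + z) ^ 2) * r2
    <= (1 - r2) ^ 2 * b2.
Proof.
intros b2 r2 Ha H1 H2 Hb Hx Hc.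
assert (Hr : 0 < r2) by (unfold r2; nra).
assert (Hr1 : r2 < 1) by (unfold r2, b2; nra).
(* [c] minimises F when h is orthogonal to m, i.e. when [h1 = 0]. *)
set (c := a * (1 + r2) / (2 * r2)).
assert (Hcr : 2 * r2 * c = a * (1 + r2)) by (unfold c; field; lra).
(* The last hypothesis says exactly that [c <= 1], so a point of the circle has abscissa [c];
   [a <= c] comes from [r2 < 1]. *)
assert (Hc1 : c <= 1) by nra.
assert (Hca : a <= c) by nra.
set (v := sqrt (1 - c ^ 2)).
assert (Hv0 : 0 <= v) by apply sqrt_pos.
assert (Hc2 : 0 <= 1 - c ^ 2) by nra.
assert (Hv : v ^ 2 = 1 - c ^ 2) by (apply pow2_sqrt; assumption).
set (l2 := (c - a) ^ 2 + v ^ 2).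
assert (Hl2 : l2 = 1 + a ^ 2 - 2 * a * c) by (unfold l2; rewrite Hv; ring).
(* The left bracket is F^2 at (c, v) for h orthogonal to m; the target level is this extremal
   value. *)
assert (Ht : ((l2 + b2) ^ 2 - 4 * b2 * v ^ 2) * r2 = (1 - r2) ^ 2 * b2).
{ assert (HA : (l2 + b2) * r2 = (1 + r2) * b2).
  { rewrite Hl2.
    replace ((1 + a ^ 2 - 2 * a * c + b2) * r2)
      with ((1 + r2) * r2 - a * (2 * r2 * c)) by (unfold r2; ring).
    rewrite Hcr; unfold r2; ring. }
  apply (Rmult_eq_reg_r r2); [|lra].
  replace (((l2 + b2) ^ 2 - 4 * b2 * v ^ 2) * r2 * r2)
    with (((l2 + b2) * r2) ^ 2 - 4 * b2 * r2 ^ 2 + b2 * (2 * r2 * c) ^ 2)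
    by (rewrite Hv; ring).
  rewrite HA, Hcr; unfold r2; ring. }
set (b := sqrt b2).
assert (Hb0 : 0 < b) by (apply sqrt_lt_R0; assumption).
assert (Hbb : b ^ 2 = b2) by (apply pow2_sqrt; lra).
(* F^2 decreases as |(p - m).h| grows, and [v * b] is the value of that product for orthogonal h. If
   it is reached, (c, v) works; otherwise the ray from m along h is used. *)
destruct (Rle_dec (v * b) ((c - a) * h1 + v * h2)) as [Hg|Hg].
- exists c, v; split; [lra|].
  rewrite cassini_poly; fold b2 l2; rewrite <- Ht.
  apply Rmult_le_compat_r; [lra|].
  assert ((v * b) ^ 2 <= ((c - a) * h1 + v * h2) ^ 2)
    by (apply pow_incr; split; [nra|assumption]).
  rewrite Rpow_mult_distr, Hbb in H. lra.
- apply Rnot_le_lt in Hg.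
  set (C := h1 / b); set (S := h2 / b).
  assert (HC : h1 = b * C) by (unfold C; field; lra).
  assert (HS : h2 = b * S) by (unfold S; field; lra).
  assert (HC0 : 0 <= C) by nra.
  assert (HS0 : 0 <= S) by nra.
  assert (HCS : C ^ 2 + S ^ 2 = 1).
  { apply (Rmult_eq_reg_l (b ^ 2)); [|nra].
    replace (b ^ 2 * (C ^ 2 + S ^ 2)) with ((b * C) ^ 2 + (b * S) ^ 2) by ring.
    rewrite <- HC, <- HS, Hbb; unfold b2; ring. }
  set (u := c - a) in *.
  assert (Hg' : u * C + v * S < v) by (rewrite HC, HS in Hg; nra).
  assert (Hu0 : 0 <= u) by (unfold u; lra).
  assert (Huv : u < v).
  { apply Rnot_le_lt; intros Hvu.
    assert (1 <= C + S) by nra. nra. }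
  assert (Hv1 : 0 < v) by lra.
  (* Square [v * S < v - u * C], replace [S ^ 2] by [1 - C ^ 2] and cancel [C]. *)
  assert (HCp : 2 * u * v <= C * l2).
  { assert (HC1 : 0 < C).
    { apply Rnot_le_lt; intros HC1. assert (C = 0) by lra.
      assert (S = 1) by nra. nra. }
    assert (0 <= v * S) by nra.
    assert (Hsq : (v * S) ^ 2 <= (v - u * C) ^ 2) by (apply pow_incr; split; lra).
    replace l2 with (u ^ 2 + v ^ 2) by reflexivity.
    apply (Rmult_le_reg_r C); [assumption|].
    assert (E : (v * S) ^ 2 = v ^ 2 * (1 - C ^ 2)) by (rewrite <- HCS; ring).
    rewrite E in Hsq. nra. }
  set (l := sqrt l2).
  assert (Hl2p : 0 < l2) by (unfold l2; nra).
  assert (Hl0 : 0 < l) by (apply sqrt_lt_R0; assumption).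
  assert (Hll : l ^ 2 = l2) by (apply pow2_sqrt; lra).
  assert (Hl2v : l <= 2 * v).
  { apply le_of_sq_le; [lra|]. rewrite Hll; unfold l2; nra. }
  (* Combines [2 * u * v <= C * l2] with [l <= 2 * v]. *)
  assert (HlC : u <= l * C).
  { apply (Rmult_le_reg_r l); [assumption|].
    replace (l * C * l) with (C * l2) by (rewrite <- Hll; ring). nra. }
  (* [L] is the distance from m to the circle in the direction (C, S) of h. *)
  assert (HD : 0 <= a ^ 2 * C ^ 2 + 1 - a ^ 2) by nra.
  pose proof (pow2_sqrt _ HD) as HDs; pose proof (sqrt_pos (a ^ 2 * C ^ 2 + 1 - a ^ 2)) as HD0.
  set (w := sqrt (a ^ 2 * C ^ 2 + 1 - a ^ 2)) in *.
  set (L := w - a * C).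
  (* The quantity [t ^ 2 + 2 * a * C * t] equals [1 - a ^ 2] at [L], is smaller at [b] because |x| <
     1, and is at least that at [l] by [HlC]. Hence [b <= L <= l]. *)
  assert (HL : L ^ 2 + 2 * a * C * L = 1 - a ^ 2) by (unfold L; nra).
  assert (Hll' : l ^ 2 + 2 * a * u = 1 - a ^ 2) by (rewrite Hll, Hl2; unfold u; ring).
  assert (Hbb' : b ^ 2 + 2 * a * C * b < 1 - a ^ 2).
  { rewrite Hbb; unfold b2. rewrite HC in Hx at 1.
    rewrite HC at 1; nra. }
  assert (HaC : 0 <= a * C) by nra.
  assert (HbL : b <= L).
  { apply Rnot_lt_le; intros HLb. unfold L in HLb.
    assert (w < b + a * C) by lra. nra. }
  assert (HLl : L <= l).
  { apply Rnot_lt_le; intros HLb.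
    assert (a * u <= a * (l * C)) by (apply Rmult_le_compat_l; assumption).
    assert (l ^ 2 < L ^ 2) by nra. assert (a * C * l <= a * C * L) by nra.
    nra. }
  exists (a + L * C), (L * S); split.
  + transitivity (a ^ 2 + 2 * a * C * L + L ^ 2 * (C ^ 2 + S ^ 2)); [ring|].
    rewrite HCS; lra.
  + rewrite <- Ht; apply Rmult_le_compat_r; [lra|].
    rewrite cassini_poly, HC, HS.
    replace ((a + L * C - a) ^ 2 + (L * S) ^ 2 + ((b * C) ^ 2 + (b * S) ^ 2))
      with (L ^ 2 * (C ^ 2 + S ^ 2) + b ^ 2 * (C ^ 2 + S ^ 2)) by ring.
    replace ((a + L * C - a) * (b * C) + L * S * (b * S))
      with (L * b * (C ^ 2 + S ^ 2)) by ring.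
    rewrite HCS, <- Hbb, <- Hll, !Rmult_1_r.
    (* On the ray p - m is parallel to h, so F is [L ^ 2 - b ^ 2]. Replacing [L] by [l] increases
       it, and [v <= l] then gives the level in [Ht]. *)
    apply Rle_trans with ((l ^ 2 - b ^ 2) ^ 2).
    * replace ((L ^ 2 + b ^ 2) ^ 2 - 4 * (L * b) ^ 2) with ((L ^ 2 - b ^ 2) ^ 2) by ring.
      apply pow_incr; nra.
    * assert (v ^ 2 <= l ^ 2) by (rewrite Hll; unfold l2; nra).
      assert (0 < b ^ 2) by nra. nra.
Qed.

(** Reduction to nonnegative coordinates of h: exchanging x and y changes h to -h, and reflection in
    the first axis changes the signs of [h2] and [z]. *)
Lemma exists_close_point (a h1 h2 : R) :
  let b2 := h1 ^ 2 + h2 ^ 2 in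
  let r2 := a ^ 2 + b2 in
  0 <= a -> 0 < b2 ->
  (a + h1) ^ 2 + h2 ^ 2 < 1 -> (a - h1) ^ 2 + h2 ^ 2 < 1 ->
  a * (1 + r2) <= 2 * r2 ->
  exists c z, c ^ 2 + z ^ 2 = 1 /\
    ((h1 - (c - a)) ^ 2 + (h2 - z) ^ 2) * ((h1 + (c - a)) ^ 2 + (h2 + z) ^ 2) * r2
    <= (1 - r2) ^ 2 * b2.
Proof.
intros b2 r2 Ha Hb Hx Hy Hc.
assert (E : Rabs h1 ^ 2 + Rabs h2 ^ 2 = b2) by (rewrite !pow2_abs; reflexivity).
destruct (exists_close_point_nonneg a (Rabs h1) (Rabs h2)) as (c & z & Hcz & H);
  rewrite ?E; try assumption; try apply Rabs_pos.
{ rewrite (pow2_abs h2).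
  unfold Rabs; destruct (Rcase_abs h1); [|assumption].
  replace (a + - h1) with (a - h1) by ring; assumption. }
rewrite E in H; fold r2 in H.
revert H; unfold Rabs; destruct (Rcase_abs h1), (Rcase_abs h2); intros H.
- exists c, z; split; [lra|]. eapply Rle_trans; [|exact H]; right; ring.
- exists c, (- z); split; [lra|]. eapply Rle_trans; [|exact H]; right; ring.
- exists c, (- z); split; [lra|]. eapply Rle_trans; [|exact H]; right; ring.
- exists c, z; split; [lra|exact H].
Qed.

(** * Coordinates rotated about the origin towards the midpoint *)

Lemma unit_direction (w : point) :
  exists e, bd_B2 e /\ fst w = norm2 w * fst e /\ snd w = norm2 w * snd e.
Proof.
pose proof (norm2_sq w) as Hw; pose proof (norm2_ge0 w) as [H|H].
- exists (fst w / norm2 w, snd w / norm2 w); simpl; repeat split; try (field; lra).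
  apply bd_B2_sq; simpl fst; simpl snd.
  replace ((fst w / norm2 w) ^ 2 + (snd w / norm2 w) ^ 2)
    with ((fst w ^ 2 + snd w ^ 2) / norm2 w ^ 2) by (field; lra).
  rewrite <- Hw; field; lra.
(* For w = 0 any unit vector serves. *)
- exists (1, 0); split; [apply bd_B2_sq; simpl; ring|].
  rewrite <- H in *; simpl fst; simpl snd; split; nra.
Qed.

(** In the orthonormal basis of [e] and its quarter turn, m is (a, 0) and h is (h1, h2). *)
Lemma midpoint_frame (x y : point) :
  exists e h1 h2, let a := norm2 (vadd x y) / 2 in
    fst e ^ 2 + snd e ^ 2 = 1 /\
    x = ((a + h1) * fst e - h2 * snd e, (a + h1) * snd e + h2 * fst e) /\
    y = ((a - h1) * fst e + h2 * snd e, (a - h1) * snd e - h2 * fst e).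
Proof.
destruct (unit_direction (vadd x y)) as (e & He & H1 & H2).
apply bd_B2_sq in He.
set (s := norm2 (vadd x y)) in *.
destruct x as [x1 x2], y as [y1 y2], e as [e1 e2]; unfold vadd in *; simpl in *.
exists (e1, e2), (((x1 - y1) * e1 + (x2 - y2) * e2) / 2),
  (((x2 - y2) * e1 - (x1 - y1) * e2) / 2); simpl.
assert (E1 : (x1 - y1) * (e1 * (e1 * 1) + e2 * (e2 * 1)) = x1 - y1) by (rewrite He; ring).
assert (E2 : (x2 - y2) * (e1 * (e1 * 1) + e2 * (e2 * 1)) = x2 - y2) by (rewrite He; ring).
split; [exact He|split; f_equal; lra].
Qed.

(** Rotations preserve distances: each squared distance only picks up the factor |e|^2 = 1. *)
Lemma cassini_frame (a h1 h2 c z : R) (e : point) :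
  fst e ^ 2 + snd e ^ 2 = 1 ->
  cassini ((a + h1) * fst e - h2 * snd e, (a + h1) * snd e + h2 * fst e)
    ((a - h1) * fst e + h2 * snd e, (a - h1) * snd e - h2 * fst e)
    (c * fst e - z * snd e, c * snd e + z * fst e) ^ 2 =
  ((h1 - (c - a)) ^ 2 + (h2 - z) ^ 2) * ((h1 + (c - a)) ^ 2 + (h2 + z) ^ 2).
Proof.
intros He; rewrite cassini_sq; simpl fst; simpl snd.
transitivity (((h1 - (c - a)) ^ 2 + (h2 - z) ^ 2) * (fst e ^ 2 + snd e ^ 2) *
  (((h1 + (c - a)) ^ 2 + (h2 + z) ^ 2) * (fst e ^ 2 + snd e ^ 2))); [ring|].
rewrite He; ring.
Qed.

(** * The three bounds, read in the rotated frame *)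

Theorem theorem3p6 (x y : point) (hx : in_B2 x) (hy : in_B2 y) :
  let s := norm2 (vadd x y) in
  let d := norm2 (vsub x y) in
  (s * (1 + 4 / (s ^ 2 + d ^ 2)) <= 4 ->
     tau_B2 x y >= ln (1 + 2 * sqrt (d * sqrt (s ^ 2 + d ^ 2) / (4 - s ^ 2 - d ^ 2)))) /\
  (s * (1 + 4 / (s ^ 2 + d ^ 2)) > 4 ->
     tau_B2 x y >= ln (1 + 2 * d / sqrt ((2 - s) ^ 2 + d ^ 2))) /\
  (s + d < 2 ->
     tau_B2 x y <= ln (1 + 2 * d / sqrt ((2 - s) ^ 2 - d ^ 2))).
Proof.
intros s d.
destruct (midpoint_frame x y) as (e & h1 & h2 & He & Ex & Ey); fold s in Ex, Ey.
set (a := s / 2) in *.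
assert (Hs0 : 0 <= s) by apply norm2_ge0.
assert (Hd0 : 0 <= d) by apply norm2_ge0.
assert (Hx1 : (a + h1) ^ 2 + h2 ^ 2 < 1).
{ apply in_B2_sq in hx; rewrite Ex in hx; simpl fst in hx; simpl snd in hx.
  replace ((a + h1) ^ 2 + h2 ^ 2)
    with (((a + h1) ^ 2 + h2 ^ 2) * (fst e ^ 2 + snd e ^ 2)) by (rewrite He; ring).
  lra. }
assert (Hy1 : (a - h1) ^ 2 + h2 ^ 2 < 1).
{ apply in_B2_sq in hy; rewrite Ey in hy; simpl fst in hy; simpl snd in hy.
  replace ((a - h1) ^ 2 + h2 ^ 2)
    with (((a - h1) ^ 2 + h2 ^ 2) * (fst e ^ 2 + snd e ^ 2)) by (rewrite He; ring).
  lra. }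
assert (Hd : d ^ 2 = 4 * (h1 ^ 2 + h2 ^ 2)).
{ transitivity (4 * (h1 ^ 2 + h2 ^ 2) * (fst e ^ 2 + snd e ^ 2)); [|rewrite He; ring].
  unfold d; rewrite norm2_sq; unfold vsub; rewrite Ex, Ey; simpl fst; simpl snd; ring. }
assert (Hbd : forall c z, c ^ 2 + z ^ 2 = 1 ->
  bd_B2 (c * fst e - z * snd e, c * snd e + z * fst e)).
{ intros c z Hcz; apply bd_B2_sq; simpl fst; simpl snd.
  transitivity ((c ^ 2 + z ^ 2) * (fst e ^ 2 + snd e ^ 2)); [ring|].
  rewrite Hcz, He; ring. }
assert (Hcas : forall c z, cassini x y (c * fst e - z * snd e, c * snd e + z * fst e) ^ 2 =
  ((h1 - (c - a)) ^ 2 + (h2 - z) ^ 2) * ((h1 + (c - a)) ^ 2 + (h2 + z) ^ 2)).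
{ intros c z; rewrite Ex, Ey; apply cassini_frame; assumption. }
assert (Hsa : s = 2 * a) by (unfold a; field).
(* Parallelogram law: the mean of [Hx1] and [Hy1]. *)
assert (Ha : a ^ 2 + (h1 ^ 2 + h2 ^ 2) < 1) by nra.
assert (Ha1 : a < 1) by nra.
clearbody a; split; [|split].
- intros Hc; apply Rle_ge.
  assert (HT : 0 < 4 - s ^ 2 - d ^ 2) by (rewrite Hd, Hsa; lra).
  destruct Hd0 as [Hd0|Hd0].
  + assert (Hb : 0 < h1 ^ 2 + h2 ^ 2) by nra.
    set (r2 := a ^ 2 + (h1 ^ 2 + h2 ^ 2)).
    assert (Hsd : s ^ 2 + d ^ 2 = 4 * r2) by (rewrite Hd, Hsa; unfold r2; ring).
    assert (Hr : 0 < r2) by (unfold r2; nra).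
    destruct (exists_close_point a h1 h2) as (c & z & Hcz & H); try assumption; [lra| |].
    (* Clearing the denominator turns the case condition into [a * (1 + r2) <= 2 * r2]. *)
    { fold r2; rewrite Hsd, Hsa in Hc.
      apply (Rmult_le_compat_r r2) in Hc; [|lra].
      replace (2 * a * (1 + 4 / (4 * r2)) * r2) with (2 * (a * (1 + r2))) in Hc
        by (field; lra).
      lra. }
    fold r2 in H; rewrite <- Hcas in H.
    pose proof (cassini_gt0 x y _ hx hy (Hbd c z Hcz)) as HG.
    apply (tau_B2_ge x y _ _ hx hy (Hbd c z Hcz)).
    { apply Rmult_le_pos; [lra|apply sqrt_pos]. }
    set (G := cassini x y _) in *; fold d.
    rewrite Rpow_mult_distr, pow2_sqrt by
      (apply Rmult_le_pos; [apply Rmult_le_pos; [lra|apply sqrt_pos]|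
        left; apply Rinv_0_lt_compat; lra]).
    rewrite Hsd.
    assert (Hr4 : 0 <= 4 * r2) by lra.
    pose proof (sqrt_pos (4 * r2)) as Hq0; pose proof (pow2_sqrt _ Hr4) as Hq.
    set (q := sqrt (4 * r2)) in *.
    replace (4 - s ^ 2 - d ^ 2) with (4 * (1 - r2)) by lra.
    (* Squared, this is four times [H]. *)
    assert (HqG : q * G <= (1 - r2) * d).
    { apply le_of_sq_le; [unfold r2; nra|]. rewrite !Rpow_mult_distr, Hq, Hd; lra. }
    apply (Rmult_le_reg_r (1 - r2)); [unfold r2; lra|].
    replace (2 ^ 2 * (d * q / (4 * (1 - r2))) * G * (1 - r2)) with (d * (q * G))
      by (field; unfold r2; lra).
    nra.
  (* Here x = y: the root collapses to 0, and any point of the circle will do. *)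
  + apply (tau_B2_ge x y _ _ hx hy (Hbd 1 0 ltac:(ring))); fold d; rewrite <- Hd0;
      rewrite Rmult_0_l; unfold Rdiv; rewrite Rmult_0_l, sqrt_0; lra.
- intros _; apply Rle_ge.
  assert (HT : 0 < (2 - s) ^ 2 + d ^ 2) by nra.
  pose proof (sqrt_lt_R0 _ HT) as HT0; pose proof (pow2_sqrt _ (Rlt_le _ _ HT)) as HTs.
  (* The frame point (1, 0) is [e], that is m/|m| when m is nonzero. *)
  apply (tau_B2_ge x y _ _ hx hy (Hbd 1 0 ltac:(ring))).
  { apply Rmult_le_pos; [lra|left; apply Rinv_0_lt_compat; assumption]. }
  pose proof (Hcas 1 0) as HG; rewrite cassini_poly in HG.
  set (G := cassini x y _) in *; fold d.
  (* Drops the subtracted square in [cassini_poly]. *)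
  assert (4 * G <= (2 - s) ^ 2 + d ^ 2).
  { apply le_of_sq_le; [lra|]. rewrite Rpow_mult_distr, HG, Hd, Hsa.
    pose proof (pow2_ge_0 ((1 - a) * h1 + 0 * h2)). lra. }
  unfold Rdiv; rewrite !Rpow_mult_distr, pow_inv, HTs.
  apply (Rmult_le_reg_r ((2 - s) ^ 2 + d ^ 2)); [assumption|].
  replace (2 ^ 2 * d ^ 2 * / ((2 - s) ^ 2 + d ^ 2) * G * ((2 - s) ^ 2 + d ^ 2))
    with (d ^ 2 * (4 * G)) by (field; lra).
  apply Rmult_le_compat_l; [apply pow2_ge_0|assumption].
- intros Hsd.
  assert (HT : 0 < (2 - s) ^ 2 - d ^ 2) by nra.
  pose proof (sqrt_lt_R0 _ HT) as HT0; pose proof (pow2_sqrt _ (Rlt_le _ _ HT)) as HTs.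
  apply (tau_B2_le x y _ hx hy).
  { apply Rmult_le_pos; [lra|left; apply Rinv_0_lt_compat; assumption]. }
  intros p Hp; pose proof (cassini_gt0 x y p hx hy Hp) as HG0; apply bd_B2_sq in Hp.
  (* Frame coordinates of an arbitrary boundary point. *)
  set (c := fst p * fst e + snd p * snd e).
  set (z := snd p * fst e - fst p * snd e).
  assert (Hcz : c ^ 2 + z ^ 2 = 1).
  { transitivity ((fst p ^ 2 + snd p ^ 2) * (fst e ^ 2 + snd e ^ 2));
      [unfold c, z; ring|rewrite Hp, He; ring]. }
  assert (Ep : p = (c * fst e - z * snd e, c * snd e + z * fst e)).
  { rewrite (surjective_pairing p) at 1; f_equal.
    - transitivity (fst p * (fst e ^ 2 + snd e ^ 2)); [rewrite He|unfold c, z]; ring.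
    - transitivity (snd p * (fst e ^ 2 + snd e ^ 2)); [rewrite He|unfold c, z]; ring. }
  pose proof (Hcas c z) as HG; rewrite <- Ep in HG.
  pose proof (cassini_poly_ge (c - a) z h1 h2) as HF; rewrite <- HG in HF.
  set (G := cassini x y p) in *; fold d.
  (* Since [c <= 1] and [0 <= a], |p - m|^2 = 1 + a^2 - 2ac is at least (1 - a)^2. *)
  assert ((2 - s) ^ 2 - d ^ 2 <= 4 * G).
  { assert (Hc1 : c <= 1) by nra.
    assert ((c - a) ^ 2 + z ^ 2 - (h1 ^ 2 + h2 ^ 2) <= G)
      by (apply le_of_sq_le; lra).
    rewrite Hd, Hsa. nra. }
  unfold Rdiv; rewrite !Rpow_mult_distr, pow_inv, HTs.
  apply (Rmult_le_reg_r ((2 - s) ^ 2 - d ^ 2)); [assumption|].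
  replace (2 ^ 2 * d ^ 2 * / ((2 - s) ^ 2 - d ^ 2) * G * ((2 - s) ^ 2 - d ^ 2))
    with (d ^ 2 * (4 * G)) by (field; lra).
  apply Rmult_le_compat_l; [apply pow2_ge_0|assumption].
Qed.
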